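(* There exists a family of unsatisfiable CNF formulas $\{F_n\}$ such that any $\mathsf{SP}^*$ refutation of $F_n$ requires size at least $2^{n^\varepsilon}$ for a constant $\varepsilon>0$.
   Context: CNFs are refuted via their standard linear-inequality encoding ($0\le x_i\le 1$ and $\sum_{i\in P}x_i+\sum_{i\in N}(1-x_i)\ge1$ for each clause $\bigvee_{i\in P}x_i\vee\bigvee_{i\in N}\neg x_i$). Stabbing Planes ($\mathsf{SP}$): a refutation is a binary tree; each internal node is labelled by a query $(ax\le b-1,ax\ge b)$ with $a\in\mathbb{Z}^n,b\in\mathbb{Z}$ whose outgoing edges carry these two inequalities; each leaf is labelled by a nonnegative linear combination of the input inequalities and those on its root path yielding $0\ge1$; size is the number of queries. $\mathsf{SP}^*$ is the subsystem of $\mathsf{SP}$ in which every coefficient has magnitude at most quasipolynomial, $n^{(\log n)^{O(1)}}$, in the number $n$ of input variables. *)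

(* Defs.v *)
From HB Require Import structures.
From mathcomp Require Import all_boot all_order all_algebra.
From mathcomp Require Import all_classical all_reals all_analysis.

Set Implicit Arguments.
Unset Strict Implicit.
Unset Printing Implicit Defensive.

Import Order.TTheory GRing.Theory Num.Theory.

Local Open Scope ring_scope.

(* (P, N) is the clause \/_(i in P) x_i \/ \/_(i in N) ~ x_i. *)
Definition clause (n : nat) : Type := ({set 'I_n} * {set 'I_n})%type.

Definition cnf (n : nat) : Type := seq (clause n).

Definition clause_sat n (x : 'I_n -> bool) (C : clause n) : bool :=
  [exists i in C.1, x i] || [exists i in C.2, ~~ x i].

Definition cnf_sat n (x : 'I_n -> bool) (F : cnf n) : bool :=
  all (clause_sat x) F.

Definition unsat n (F : cnf n) : Prop :=
  forall x : 'I_n -> bool, ~~ cnf_sat x F.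

(* A clause over n variables has at most 2n literals, so bounding the number
   of clauses by a polynomial in n bounds the size of the formulas. *)
Definition poly_size (F : forall n, cnf n) : Prop :=
  exists k : nat, forall n : nat, (size (F n) <= n ^ k + k)%N.

(* (a, b) is the inequality a x >= b. *)
Definition ineq (n : nat) : Type := ('rV[int]_n * int)%type.

(* sum_(i in P) x_i + sum_(i in N) (1 - x_i) >= 1 with the constants moved to
   the right-hand side; see clause_ineqE. *)
Definition clause_ineq n (C : clause n) : ineq n :=
  (\row_i ((i \in C.1)%:Z - (i \in C.2)%:Z), 1 - #|C.2|%:Z).

Definition lower_ineq n (i : 'I_n) : ineq n := (delta_mx 0 i, 0).

Definition upper_ineq n (i : 'I_n) : ineq n := (- delta_mx 0 i, -1).

Definition encoding n (F : cnf n) : seq (ineq n) :=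
  map (@clause_ineq n) F ++
  map (@lower_ineq n) (enum 'I_n) ++ map (@upper_ineq n) (enum 'I_n).

(* Query a b l r branches on a x <= b - 1 (subtree l) and a x >= b (subtree r);
   a leaf carries the multipliers of its linear combination. *)
Inductive sp_tree (n : nat) : Type :=
| Leaf of seq rat
| Query of 'rV[int]_n & int & sp_tree n & sp_tree n.

(* The multipliers lam, aligned with S, combine the inequalities of S into
   0 >= 1. *)
Definition farkas n (S : seq (ineq n)) (lam : seq rat) : Prop :=
  [/\ size lam = size S,
      all (fun l : rat => 0 <= l) lam,
      \sum_(p <- zip lam S) p.1 *: map_mx intr p.2.1 = 0 :> 'rV[rat]_n
    & \sum_(p <- zip lam S) p.1 * p.2.2%:~R = 1].

(* S collects the inequalities available at the root of T. *)
Fixpoint sp_refutes n (S : seq (ineq n)) (T : sp_tree n) : Prop :=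
  match T with
  | Leaf lam => farkas S lam
  | Query a b l r =>
      sp_refutes ((- a, 1 - b) :: S) l /\ sp_refutes ((a, b) :: S) r
  end.

Definition sp_refutation n (F : cnf n) (T : sp_tree n) : Prop :=
  sp_refutes (encoding F) T.

Fixpoint sp_size n (T : sp_tree n) : nat :=
  match T with
  | Leaf _ => 0
  | Query _ _ l r => (sp_size l + sp_size r).+1
  end.

Fixpoint sp_coefs n (T : sp_tree n) : seq int :=
  match T with
  | Leaf _ => [::]
  | Query a b l r =>
      b :: [seq a 0 i | i <- enum 'I_n] ++ sp_coefs l ++ sp_coefs r
  end.

(* n ^ ((log_2 n) ^ c) *)
Definition quasipoly (R : realType) (c n : nat) : R :=
  n%:R `^ ((ln n%:R / ln 2) ^+ c).

(* SP* refutations for the value c of the exponent O(1) in the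
   quasipolynomial bound. *)
Definition spstar_refutation (R : realType) (c : nat) n
    (F : cnf n) (T : sp_tree n) : Prop :=
  sp_refutation F T /\
  {in sp_coefs T, forall z : int, `|z|%:~R <= quasipoly R c n}.

Lemma clause_ineqE (R : realDomainType) n (C : clause n) (x : 'I_n -> R) :
  ((clause_ineq C).2%:~R <= \sum_i ((clause_ineq C).1 0 i)%:~R * x i) =
  (1 <= \sum_(i in C.1) x i + \sum_(i in C.2) (1 - x i)).
Proof.
have -> : \sum_i ((clause_ineq C).1 0 i)%:~R * x i =
    \sum_(i in C.1) x i - \sum_(i in C.2) x i.
  rewrite [in RHS]big_mkcond [\sum_(i in C.2) x i]big_mkcond -sumrB.
  apply: eq_bigr => i _; rewrite mxE.
  by do 2 case: (_ \in _); rewrite ?subrr ?subr0 ?sub0r ?mul0r ?mul1r ?mulN1r.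
rewrite sumrB sumr_const /= rmorphB /= lerBlDr.
by rewrite addrAC addrA addrAC.
Qed.

(* Main.v *)
(* Split the variables into two halves, assigned by [a] and [b].  A linear
   inequality is falsified by the pairs [(a, b)] with [F a + G b < c], a set that
   is a "triangle"; a semantic cutting planes refutation thus becomes a sequence
   of triangles reaching the full set, each covered by two earlier ones or by an
   earlier one and an axiom.

   A stabbing planes tree is turned into such a sequence by replacing a query on
   [e x] by one step for every integer value of [e x]: a refutation of the face
   [e x = m] lifts to a derivation of [e x >= m + 1] from [e x >= m]. Only the
   smaller subtree is repeated, so that a tree of size [s] with coefficients
   bounded by [M] gives at most about [s (n M)^(log s)] triangles.

   Triangle sequences are bounded from below by the method of symmetric
   approximations (Razborov, Pudlak, Jukna): every triangle is approximated by
   two integer-valued monotone functions, a maximum of small monomials and a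
   minimum of small clauses, in variables indexed by the clauses of the CNF.
   This works as soon as any [k + 1] clauses of the CNF are simultaneously
   falsified on one half with very small probability. A CNF whose clauses are
   supported on the edges of an expanding hypergraph (which exists by counting)
   has this property for any choice of signs, and signs that make it
   unsatisfiable are chosen greedily. *)

Require Import Defs.
From HB Require Import structures.
From mathcomp Require Import all_boot all_order all_algebra.
From mathcomp Require Import all_classical all_reals all_analysis.
From mathcomp Require Import fintype finset ring lra zify.

Set Implicit Arguments.
Unset Strict Implicit.
Unset Printing Implicit Defensive.

Import Order.TTheory GRing.Theory Num.Theory.

(** * Approximation of monotone functions *)

Section Approximation.
Variable I : finType.
Implicit Types (p q c M : {set I}) (E : {set {set I}}) (f g : {set I} -> int).

Definition mono f := forall p q, p \subset q -> (f p <= f q)%R.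

(* [f] is a maximum of weighted monomials with at most [k] variables each;
   [cnf_like] is the dual notion, a minimum of weighted clauses. *)
Definition dnf_like k f :=
  forall p, exists M, [/\ M \subset p, #|M| <= k & (f p <= f M)%R].

Definition cnf_like k f :=
  forall p, exists c, [/\ c \subset ~: p, #|c| <= k & (f (~: c) <= f p)%R].

Definition avoids E p := forall M, M \in E -> ~~ (M \subset p).

Lemma avoidsU E1 E2 p : avoids (E1 :|: E2) p -> avoids E1 p /\ avoids E2 p.
Proof. by move=> H; split=> M ME; apply: H; rewrite inE ME ?orbT. Qed.

(* The error monomials are the nodes at depth [k.+1] of the decision tree that
   branches, at a monomial [M], over the clause certifying the value of [f]
   at [M]. *)
Lemma dnf_approximation l k f : mono f -> cnf_like l f ->
  exists g E, [/\ mono g /\ dnf_like k g, forall p, (g p <= f p)%R,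
    #|E| <= l ^ k.+1, forall M, M \in E -> #|M| = k.+1
    & forall p, avoids E p -> (f p <= g p)%R].
Proof.
move=> fmono /boolp.choice[c cP].
pose P p := [pred M : {set I} | (M \subset p) && (#|M| <= k)].
pose best p := [arg max_(M > set0 | P p M) f M]%O.
have P0 p : P p set0 by rewrite inE sub0set cards0.
have bestP p : P p (best p) /\ forall M, P p M -> (f M <= f (best p))%R.
  by rewrite /best; case: arg_maxP => //.
pose step E := \bigcup_(M in E) [set i |: M | i in c M].
pose E j := iter j step [set set0].
have card_step F : #|step F| <= #|F| * l.
  rewrite /step -sum_nat_const.
  elim/big_rec2: _ => [|M n S _ IH]; first by rewrite cards0.
  rewrite (leq_trans (leq_card_setU _ _)) // leq_add //.
  by have [_ h _] := cP M; exact: leq_trans (leq_imset_card _ _) h.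
have cardE j M : M \in E j -> #|M| = j.
  elim: j M => [|j IH] M /=; first by rewrite inE => /eqP ->; rewrite cards0.
  case/bigcupP=> M' /IH M'j /imsetP[i ic ->].
  rewrite cardsU1 M'j; have [/fintype.subsetP h _ _] := cP M'.
  by have := h _ ic; rewrite inE => ->.
exists (fun p => f (best p)), (E k.+1); split.
- split=> p => [q pq|].
    have [/andP[h1 h2] _] := bestP p; have [_] := bestP q; apply.
    by rewrite inE h2 (subset_trans h1).
  have [/andP[h1 h2] _] := bestP p; exists (best p); split=> //.
  by have [_] := bestP (best p); apply; rewrite inE subxx.
- by move=> p; have [/andP[h1 _] _] := bestP p; exact: fmono.
- elim: k.+1 => [|j IH]; first by rewrite cards1.
  by rewrite /= expnSr (leq_trans (card_step _)) // leq_mul2r IH orbT.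
- exact: cardE.
move=> p; apply: contraPT; rewrite -ltNge => gf avE.
suff [M ME Mp] : exists2 M, M \in E k.+1 & M \subset p.
  by have := avE M ME; rewrite Mp.
have: k.+1 <= k.+1 by [].
elim: {1 3}k.+1 => [|j IH] jk; first by exists set0; rewrite ?sub0set // inE.
have [M ME Mp] := IH (ltnW jk).
have fM : (f M <= f (best p))%R.
  by have [_] := bestP p; apply; rewrite inE Mp (cardE _ _ ME).
have [_ _ h] := cP M.
have : ~~ [disjoint c M & p].
  apply/negP; rewrite disjoint_sym => dj.
  have pc : p \subset ~: c M by rewrite -disjoints_subset.
  by have := le_lt_trans (le_trans (le_trans (fmono _ _ pc) h) fM) gf; rewrite ltxx.
case/pred0Pn=> i /andP[ic ip]; exists (i |: M).
  by apply/bigcupP; exists M => //; apply: imset_f.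
by rewrite subUset sub1set Mp andbT; exact: ip.
Qed.

(** Duality: [p |-> - f (~: p)] exchanges monomials and clauses, so the errors are tested on
    [~: p]. *)
Lemma cnf_approximation l k f : mono f -> dnf_like l f ->
  exists g E, [/\ mono g /\ cnf_like k g, forall p, (f p <= g p)%R,
    #|E| <= l ^ k.+1, forall M, M \in E -> #|M| = k.+1
    & forall p, avoids E (~: p) -> (g p <= f p)%R].
Proof.
move=> fmono fd.
have [||g [E [[gm gd] gf Ec Ek Eg]]] := @dnf_approximation l k (fun p => - f (~: p))%R.
- by move=> p q pq; rewrite lerN2 fmono // setCS.
- move=> p; have [M [Mp Mk fM]] := fd (~: p).
  by exists M; split=> //; rewrite setCK lerN2.
exists (fun p => - g (~: p))%R, E; split=> //.
- split=> p => [q pq|]; first by rewrite lerN2 gm // setCS.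
  have [M [Mp Mk gM]] := gd (~: p).
  by exists M; split=> //; rewrite setCK lerN2.
- by move=> p; have := gf (~: p); rewrite setCK lerNr.
- by move=> p /Eg; rewrite setCK lerNl.
Qed.

Lemma mono_comp2 (phi : int -> int -> int) f g :
  (forall x x' y y', x <= x' -> y <= y' -> phi x y <= phi x' y')%R ->
  mono f -> mono g -> mono (fun p => phi (f p) (g p)).
Proof. by move=> pm fm gm p q pq; apply: pm; [apply: fm | apply: gm]. Qed.

Lemma dnf_like_comp2 (phi : int -> int -> int) k f g :
  (forall x x' y y', x <= x' -> y <= y' -> phi x y <= phi x' y')%R ->
  mono f -> mono g -> dnf_like k f -> dnf_like k g ->
  dnf_like (k.*2) (fun p => phi (f p) (g p)).
Proof.
move=> pm fm gm fd gd p.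
have [M [Mp Mk fM]] := fd p; have [M' [M'p M'k gM]] := gd p.
exists (M :|: M'); split; first by rewrite subUset Mp.
  by rewrite -addnn (leq_trans (leq_card_setU _ _)) // leq_add.
apply: pm; first exact: le_trans fM (fm _ _ (subsetUl _ _)).
exact: le_trans gM (gm _ _ (subsetUr _ _)).
Qed.

Lemma cnf_like_comp2 (phi : int -> int -> int) k f g :
  (forall x x' y y', x <= x' -> y <= y' -> phi x y <= phi x' y')%R ->
  mono f -> mono g -> cnf_like k f -> cnf_like k g ->
  cnf_like (k.*2) (fun p => phi (f p) (g p)).
Proof.
move=> pm fm gm fd gd p.
have [M [Mp Mk fM]] := fd p; have [M' [M'p M'k gM]] := gd p.
exists (M :|: M'); split; first by rewrite subUset Mp.
  by rewrite -addnn (leq_trans (leq_card_setU _ _)) // leq_add.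
apply: pm; first by apply: le_trans (fm _ _ _) fM; rewrite setCS subsetUl.
by apply: le_trans (gm _ _ _) gM; rewrite setCS subsetUr.
Qed.

End Approximation.

(** * Triangle sequences *)

Section TriangleDag.
Variables A B : finType.
Implicit Types (T : {set A * B}) (Ax : {set A * B} -> Prop).

(** Combinatorial form of the sets [F a + G b < c]: the rows are linearly ordered by inclusion. *)
Definition triangle T := forall a a' b b',
  (a, b) \in T -> (a', b') \in T -> ((a, b') \in T) || ((a', b) \in T).

Lemma triangle0 : triangle set0.
Proof. by move=> a a' b b'; rewrite inE. Qed.

(* A line is represented by the set of assignments falsifying it, so a rule
   is sound when the falsified set of its conclusion is covered by those of its
   premises. At most one premise is an axiom: this is what makes [dag_lift]
   below go through without extra lines. *)
Fixpoint dag Ax (s : seq {set A * B}) : Prop :=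
  if s is T :: s' then
    [/\ triangle T,
        T = set0 \/ exists T1 T2,
          [/\ Ax T1 \/ T1 \in s', T2 \in s' & T \subset T1 :|: T2]
      & dag Ax s']
  else True.

Lemma dag_triangle Ax s T : dag Ax s -> T \in s -> triangle T.
Proof.
elim: s => [//|T' s IH] /= [tT _ ds]; rewrite inE => /orP[/eqP -> //|].
exact: IH.
Qed.

Definition level T a := #|[set b | (a, b) \in T]|.
Definition colevel T b := \max_(a | (a, b) \notin T) level T a.

(** A row omitting [b] lies strictly inside any row containing [b]. Integer thresholds thus describe
    every triangle, whatever numbers defined it. *)
Lemma in_triangle T a b : triangle T ->
  ((a, b) \in T) = (colevel T b < level T a).
Proof.
move=> tT; case: (boolP ((a, b) \in T)) => [abT|abT]; last first.
  by apply/esym/negbTE; rewrite -leqNgt /colevel (leq_bigmax_cond a).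
apply/esym; rewrite /colevel.
have lt a' : (a', b) \notin T -> level T a' < level T a.
  move=> a'bT; apply: proper_card; apply/properP; split.
    apply/fintype.subsetP=> b'; rewrite !inE => a'b'T.
    by have := tT _ _ _ _ abT a'b'T; rewrite (negbTE a'bT) orbF.
  by exists b; rewrite !inE // abT.
elim/big_ind: _ => [|x y hx hy|//]; last by rewrite gtn_max hx.
by apply/card_gt0P; exists b; rewrite inE.
Qed.

Variables (I : finType) (U : A -> {set I}) (W : B -> {set I}) (k : nat).
Implicit Types EU EW : {set {set I}}.

(** [U a] and [W b] stand for the clauses falsified on each half. If they are disjoint then
    [U a \subset ~: W b], and monotonicity of [f] or [g] forces [level T a <= colevel T b], that is,
    [(a, b) \notin T], unless an error occurs. *)
Definition approximated EU EW T := exists f g, [/\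
  mono f /\ dnf_like k f, mono g /\ cnf_like k g,
  forall a, avoids EU (U a) ->
    ((level T a)%:Z <= f (U a))%R /\ ((level T a)%:Z <= g (U a))%R
  & forall b, avoids EW (W b) ->
    (f (~: W b) <= (colevel T b)%:Z)%R /\ (g (~: W b) <= (colevel T b)%:Z)%R].

Lemma approximatedW EU EW EU' EW' T : EU \subset EU' -> EW \subset EW' ->
  approximated EU EW T -> approximated EU' EW' T.
Proof.
move=> sU sW [f [g [hf hg hU hW]]]; exists f, g; split=> //.
  by move=> a av; apply: hU => M ME; apply: av; apply: (fintype.subsetP sU).
by move=> a av; apply: hW => M ME; apply: av; apply: (fintype.subsetP sW).
Qed.

Lemma approximated0 EU EW : approximated EU EW set0.
Proof.
exists (fun=> 0%R), (fun=> 0%R); split=> //.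
- by split=> // p; exists set0; rewrite sub0set cards0.
- by split=> // p; exists set0; rewrite sub0set cards0.
- move=> a _; suff -> : level set0 a = 0 by [].
  by apply/eqP; rewrite cards_eq0; apply/eqP/setP=> b; rewrite !inE.
Qed.

(** A weighted single variable [i] is both a monomial and a clause, so no error arises. *)
Lemma approximated_rectangle EU EW T i : 0 < k -> triangle T ->
  (forall a b, (a, b) \in T -> i \in U a /\ i \in W b) -> approximated EU EW T.
Proof.
move=> k0 tT Ti; pose m := \max_a level T a.
pose f (p : {set I}) := Posz (if i \in p then m else 0).
have fm : mono f.
  move=> p q /fintype.subsetP pq; rewrite /f.
  by case: ifP => [/pq -> //|_]; rewrite lez_nat.
have lf a : ((level T a)%:Z <= f (U a))%R.
  rewrite /f lez_nat; case: ifP => [_|/negbT iU].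
    exact: (leq_bigmax_cond a).
  rewrite leqn0 cards_eq0; apply/eqP/setP=> b; rewrite !inE.
  by apply/negP=> /Ti[]; rewrite (negbTE iU).
have cf b : (f (~: W b) <= (colevel T b)%:Z)%R.
  rewrite /f lez_nat inE; case: ifP => // iW; apply/bigmax_leqP=> a _.
  apply: leq_bigmax_cond; apply/negP=> /Ti[_].
  by rewrite (negbTE iW).
exists f, f; split=> //; split=> // p; rewrite /f.
- case: ifP => ip; last by exists set0; rewrite sub0set cards0 lez_nat.
  by exists [set i]; rewrite sub1set ip cards1 inE eqxx.
- case: ifP => ip.
    exists set0; rewrite sub0set cards0; split=> //.
    by case: ifP; rewrite lez_nat.
  by exists [set i]; rewrite sub1set inE ip cards1 !inE eqxx.
Qed.

Lemma approximated_step EU EW T T1 T2 : triangle T -> triangle T1 ->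
  triangle T2 -> T \subset T1 :|: T2 ->
  approximated EU EW T1 -> approximated EU EW T2 ->
  exists EU' EW', [/\ approximated (EU :|: EU') (EW :|: EW') T,
    #|EU'| <= k.*2 ^ k.+1, #|EW'| <= k.*2 ^ k.+1,
    forall M, M \in EU' -> #|M| = k.+1 & forall M, M \in EW' -> #|M| = k.+1].
Proof.
move=> tT tT1 tT2 /fintype.subsetP sT [f1 [g1 [[f1m f1d] [g1m g1c] U1 W1]]].
move=> [f2 [g2 [[f2m f2d] [g2m g2c] U2 W2]]].
(* A monotone bound on the level in [T] given bounds on the levels in [T1] and [T2]. At the colevels
   of [b], every [a] that it counts has [(a, b)] outside [T1] and [T2], hence outside [T]. *)
pose phi (x y : int) : int :=
  (\max_(a | ((level T1 a)%:Z <= x)%R && ((level T2 a)%:Z <= y)%R) level T a)%:Z%R.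
have phim x x' y y' : (x <= x' -> y <= y' -> phi x y <= phi x' y')%R.
  move=> xx' yy'; rewrite lez_nat; apply/bigmax_leqP=> a /andP[ax ay].
  by apply: leq_bigmax_cond; rewrite (le_trans ax) // (le_trans ay).
have phiU a : ((level T a)%:Z <= phi (level T1 a)%:Z (level T2 a)%:Z)%R.
  by rewrite lez_nat leq_bigmax_cond // !lexx.
have phiW b : (phi (colevel T1 b)%:Z (colevel T2 b)%:Z <= (colevel T b)%:Z)%R.
  rewrite lez_nat; apply/bigmax_leqP=> a; rewrite !lez_nat => /andP[a1 a2].
  apply: leq_bigmax_cond; apply/negP=> /sT.
  by rewrite inE !in_triangle // !ltnNge a1 a2.
(* The roles cross: the new [f] approximates the combined [g1], [g2] from below and errs only on the
   [U] side; the new [g] approximates the combined [f1], [f2] from above and errs only on the [W]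
   side. *)
have [f [EU' [[fm fd] lef cEU kEU geU]]] :=
  dnf_approximation k (mono_comp2 phim g1m g2m)
    (cnf_like_comp2 phim g1m g2m g1c g2c).
have [g [EW' [[gm gc] leg cEW kEW geW]]] :=
  cnf_approximation k (mono_comp2 phim f1m f2m)
    (dnf_like_comp2 phim f1m f2m f1d f2d).
exists EU', EW'; split=> //; exists f, g; split=> //.
- move=> a /avoidsU[av av']; have [h1 h1'] := U1 a av; have [h2 h2'] := U2 a av.
  split; first by apply: le_trans (geU _ av'); apply: le_trans (phiU a) _; apply: phim.
  by apply: le_trans (leg _); apply: le_trans (phiU a) _; apply: phim.
- move=> b /avoidsU[av av']; have [h1 h1'] := W1 b av; have [h2 h2'] := W2 b av.
  split; first by apply: le_trans (lef _) _; apply: le_trans (phiW b); apply: phim.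
  apply: le_trans (geW _ _) _; first by rewrite setCK.
  by apply: le_trans (phiW b); apply: phim.
Qed.

Definition elementary Ax := forall T, Ax T -> triangle T /\
  (T = set0 \/ exists i, forall a b, (a, b) \in T -> i \in U a /\ i \in W b).

Lemma dag_approximated Ax s : 0 < k -> elementary Ax -> dag Ax s ->
  exists EU EW, [/\ forall T, T \in s -> approximated EU EW T,
    #|EU| <= size s * k.*2 ^ k.+1, #|EW| <= size s * k.*2 ^ k.+1,
    forall M, M \in EU -> #|M| = k.+1 & forall M, M \in EW -> #|M| = k.+1].
Proof.
move=> k0 elA; elim: s => [|T s IH] /=.
  by exists set0, set0; rewrite cards0; split=> // M; rewrite inE.
move=> [tT hT ds]; have [EU [EW [ap cU cW kU kW]]] := IH ds.
case: hT => [-> | [T1 [T2 [h1 h2 sT]]]].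
  exists EU, EW; split=> //.
  - by move=> T'; rewrite inE => /orP[/eqP ->|/ap //]; exact: approximated0.
  - by rewrite (leq_trans cU) // leq_mul2r leqnSn orbT.
  - by rewrite (leq_trans cW) // leq_mul2r leqnSn orbT.
have [tT1 ap1] : triangle T1 /\ approximated EU EW T1.
  case: h1 => [/elA[tT1 hT1]|T1s]; last first.
    by split; [exact: dag_triangle ds T1s | exact: ap].
  split=> //; case: hT1 => [->|[i hi]]; first exact: approximated0.
  exact: approximated_rectangle hi.
have [EU' [EW' [ap' cU' cW' kU' kW']]] :=
  approximated_step tT tT1 (dag_triangle ds h2) sT ap1 (ap _ h2).
exists (EU :|: EU'), (EW :|: EW'); split.
- move=> T'; rewrite inE => /orP[/eqP -> //|/ap].
  by apply: approximatedW; apply: subsetUl.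
- by rewrite (leq_trans (leq_card_setU _ _)) // mulSn addnC leq_add.
- by rewrite (leq_trans (leq_card_setU _ _)) // mulSn addnC leq_add.
- by move=> M; rewrite inE => /orP[/kU|/kU'].
- by move=> M; rewrite inE => /orP[/kW|/kW'].
Qed.

Lemma card_hits (X : finType) (F : X -> {set I}) (E : {set {set I}}) N :
  (forall M, M \in E -> #|[set x | M \subset F x]| * N <= #|X|) ->
  #|[set x | [exists M in E, M \subset F x]]| * N <= #|E| * #|X|.
Proof.
move=> h; have -> : [set x | [exists M in E, M \subset F x]] =
    \bigcup_(M in E) [set x | M \subset F x].
  apply/setP=> x; rewrite inE; apply/exists_inP/bigcupP => -[M ME];
    by rewrite ?inE => Mx; exists M; rewrite ?inE.
rewrite -[leqRHS]sum_nat_const.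
apply: (@leq_trans (\sum_(M in E) #|[set x | M \subset F x]| * N)).
  2: exact: leq_sum.
rewrite -big_distrl leq_mul2r; apply/orP; right.
elim/big_rec2: _ => [|M n S _ IH]; first by rewrite cards0.
by rewrite (leq_trans (leq_card_setU _ _)) // leq_add.
Qed.

Lemma avoidsP (E : {set {set I}}) p :
  reflect (avoids E p) (~~ [exists M in E, M \subset p]).
Proof.
apply: (iffP idP) => [/exists_inPn //|h]; apply/exists_inPn => M; exact: h.
Qed.

(** With fewer than [2 ^ k] lines, errors affect less than half of each side. For an error-free [b],
    the clause certifying [g] at [~: W b] has at most [k] indices and meets [U a] for every
    error-free [a], since [(a, b)] is in [setT]. But it meets [U a] with probability at most
    [k / (4 k)], and 1/2 + 1/4 < 1. *)
Lemma dag_size Ax s : 0 < k -> 0 < #|A| -> 0 < #|B| -> elementary Ax ->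
  (forall M : {set I}, #|M| = k.+1 ->
     #|[set a | M \subset U a]| * (4 * k) ^ k.+1 <= #|A|) ->
  (forall M : {set I}, #|M| = k.+1 ->
     #|[set b | M \subset W b]| * (4 * k) ^ k.+1 <= #|B|) ->
  (forall i, #|[set a | i \in U a]| * (4 * k) <= #|A|) ->
  dag Ax s -> setT \in s -> 2 ^ k <= size s.
Proof.
move=> k0 A0 B0 elA hU hW hi ds Ts; rewrite leqNgt; apply/negP=> small.
have [EU [EW [ap cU cW kU kW]]] := dag_approximated k0 elA ds.
have few (X : finType) (F : X -> {set I}) (E : {set {set I}}) : 0 < #|X| ->
    #|E| <= size s * k.*2 ^ k.+1 ->
    (forall M, M \in E -> #|[set x | M \subset F x]| * (4 * k) ^ k.+1 <= #|X|) ->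
    #|[set x | [exists M in E, M \subset F x]]| * 2 < #|X|.
  move=> X0 cE hE; have := card_hits hE.
  set bad := #|_|; set r := #|E| in cE * => h.
  have e : ((4 * k) ^ k.+1 = 2 ^ k.+1 * k.*2 ^ k.+1)%N.
    by rewrite -expnMn -muln2; congr (_ ^ _); lia.
  have p0 : 0 < k.*2 ^ k.+1 by rewrite expn_gt0 double_gt0 k0.
  have {}h : bad * 2 ^ k.+1 <= size s * #|X|.
    rewrite -(leq_pmul2r p0) -mulnA -e (leq_trans h) //.
    by rewrite mulnAC leq_mul2r cE orbT.
  rewrite -(@ltn_pmul2r (2 ^ k)) ?expn_gt0 // -mulnA -expnS.
  by rewrite (leq_ltn_trans h) // mulnC ltn_pmul2l.
have fewU := few _ U EU A0 cU (fun M ME => hU M (kU M ME)).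
have fewW := few _ W EW B0 cW (fun M ME => hW M (kW M ME)).
have [b avb] : exists b, avoids EW (W b).
  apply: contrapT => nob; move: fewW.
  rewrite (_ : [set _ | _] = setT) ?cardsT ?ltnNge ?leq_pmulr //.
  apply/setP=> b; rewrite !inE; apply: contrapT => /negP/avoidsP h.
  by apply: nob; exists b.
have [f [g [_ [gm gc] hlev hcol]]] := ap _ Ts.
have [_ gb] := hcol b avb; have [c [cW' ck gC]] := gc (~: W b).
have hit a : avoids EU (U a) -> ~~ [disjoint c & U a].
  move=> /hlev[_ ga]; rewrite disjoint_sym disjoints_subset; apply/negP => /gm h.
  have := le_trans (le_trans ga h) (le_trans gC gb).
  by rewrite lez_nat leqNgt -in_triangle ?inE //; exact: dag_triangle ds Ts.
have hitc : #|[set a | ~~ [disjoint c & U a]]| * 4 <= #|A|.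
  rewrite -(@leq_pmul2r k) // -mulnA.
  pose E := [set [set i] | i in c].
  have := @card_hits A U E (4 * k).
  have -> : [set a | [exists M in E, M \subset U a]] =
      [set a | ~~ [disjoint c & U a]].
    apply/setP=> a; rewrite !inE; apply/exists_inP/pred0Pn.
      by move=> [_ /imsetP[i ic ->]]; rewrite sub1set => iU; exists i; apply/andP.
    move=> [i /andP[ic iU]]; exists [set i]; first exact: imset_f.
    by rewrite sub1set.
  move=> h; apply: leq_trans (h _) _.
    move=> _ /imsetP[i ic ->]; apply: leq_trans (hi i); rewrite leq_mul2r.
    apply/orP; right; apply: subset_leq_card.
    by apply/fintype.subsetP=> a; rewrite !inE sub1set.
  by rewrite mulnC leq_mul2l (card_imset _ set1_inj) ck orbT.
have : #|A| <= #|[set a | [exists M in EU, M \subset U a]]| +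
               #|[set a | ~~ [disjoint c & U a]]|.
  rewrite -cardsT; apply: leq_trans (leq_card_setU _ _).
  apply: subset_leq_card; apply/fintype.subsetP=> a _; rewrite !inE.
  by case: (boolP [exists M in EU, _]) => //= /avoidsP/hit.
lia.
Qed.

End TriangleDag.

(** * From stabbing planes to triangle sequences *)

Lemma triangle_sum (R : realDomainType) (A B : finType) (F : A -> R) (G : B -> R)
  (c : R) : triangle [set ab : A * B | (F ab.1 + G ab.2 < c)%R].
Proof.
move=> a a' b b'; rewrite !inE /= => h h'.
by case: (ltP (F a + G b')%R c) => //= h1; lra.
Qed.

Section Lift.
Variables (A B : finType) (u : A -> int) (v : B -> int).
Implicit Types (T : {set A * B}) (Ax : {set A * B} -> Prop) (m : int).

Definition below m : {set A * B} := [set ab | (u ab.1 + v ab.2 < m)%R].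
(** This mimics adding a large multiple of [u + v >= m] to the line [T]: away from the face
    [u + v = m] that inequality decides. *)
Definition lift m T := below m :|: [set ab | (u ab.1 + v ab.2 == m)%R] :&: T.

(** The cross sums have the same total as the given ones, so one is below [m] or all four equal [m]
    and [T] decides. *)
Lemma triangle_lift m T : triangle T -> triangle (lift m T).
Proof.
move=> tT a a' b b'; rewrite !inE /=.
case: (ltgtP (u a + v b')%R m) => //= h1;
  case: (ltgtP (u a' + v b)%R m) => h2; rewrite ?orbT //=.
- by move=> /orP[h3|/andP[/eqP h3 _]] /orP[h4|/andP[/eqP h4 _]]; lia.
- by move=> /orP[h3|/andP[/eqP h3 _]] /orP[h4|/andP[/eqP h4 _]]; lia.
- by move=> /orP[h3|/andP[/eqP h3 _]] /orP[h4|/andP[/eqP h4 _]]; lia.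
- case/orP=> [h3|/andP[/eqP h3 abT]]; case/orP=> [h4|/andP[/eqP h4 abT']];
    by [lia | lia | lia | exact: tT].
Qed.

Lemma lift0 m : lift m set0 = below m.
Proof. by rewrite /lift setI0 setU0. Qed.

Lemma liftT m : lift m setT = below (m + 1).
Proof. by apply/setP=> ab; rewrite !inE andbT; lia. Qed.

Lemma dag_cat Ax Ax' s s0 T0 : dag Ax s0 -> T0 \in s0 ->
  (forall T, Ax' T -> Ax T \/ T = T0) -> dag Ax' s -> dag Ax (s ++ s0).
Proof.
move=> ds0 T0s AA; elim: s => //= T s IH [tT hT /IH ds]; split=> //.
case: hT => [|[T1 [T2 [h1 h2 sT]]]]; [by left | right].
exists T1, T2; split=> //; last by rewrite mem_cat h2.
case: h1 => [/AA[]|]; first by left.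
  by move=> ->; right; rewrite mem_cat T0s orbT.
by move=> h1; right; rewrite mem_cat h1.
Qed.

(* On [{u + v = m}] the lifted derivation is the original one, hence a
   refutation of the face [{u + v = m}] becomes a derivation of [u + v >= m + 1]
   from [u + v >= m]. *)
Lemma dag_lift Ax Ax' s s0 m : dag Ax s0 -> below m \in s0 ->
  (forall T, Ax' T -> Ax T \/ forall ab, ab \in T -> (m < u ab.1 + v ab.2)%R) ->
  dag Ax' s -> dag Ax (map (lift m) s ++ s0).
Proof.
move=> ds0 ms0 AA; elim: s => //= T s IH [tT hT /IH ds]; split=> //.
  exact: triangle_lift.
have inl T' : T' \in s -> lift m T' \in map (lift m) s ++ s0.
  by move=> Ts; rewrite mem_cat map_f.
right; case: hT => [->|[T1 [T2 [h1 h2 /fintype.subsetP sT]]]].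
  exists (below m), (below m); split; try by rewrite mem_cat ms0 orbT.
    by right; rewrite mem_cat ms0 orbT.
  by rewrite lift0 subsetUl.
have sub T1' : (forall ab, ab \in T1 -> (u ab.1 + v ab.2 == m)%R ->
    ab \in T1' :|: lift m T2) -> lift m T \subset T1' :|: lift m T2.
  move=> h; apply/fintype.subsetP=> ab; rewrite {1}/lift inE => /orP[h'|].
    by rewrite 2!inE h' orbT.
  rewrite 2!inE => /andP[e /sT]; rewrite inE => /orP[/h|abT]; first exact.
  by rewrite !inE e abT !orbT.
case: h1 => [/AA[A1|A1]|T1s].
- exists T1, (lift m T2); split; [by left | exact: inl | apply: sub].
  by move=> ab abT _; rewrite inE abT.
- exists (lift m T2), (lift m T2); split; [by right; exact: inl | exact: inl |].
  by apply: sub => ab /A1 + /eqP e; rewrite e ltxx.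
- exists (lift m T1), (lift m T2); split; [by right; exact: inl | exact: inl |].
  by apply: sub => ab abT e; rewrite !inE e abT orbT.
Qed.

(** Each of [j] rounds of [dag_lift] turns [setT] into the next [below], by [liftT]. Axioms
    falsified only where [u + v >= m + j] are empty on every face visited. *)
Lemma dag_climb Ax Ax' s m j s0 : dag Ax s0 -> below m \in s0 ->
  (forall T, Ax' T -> Ax T \/
    forall ab, ab \in T -> (m + j%:Z <= u ab.1 + v ab.2)%R) ->
  dag Ax' s -> setT \in s ->
  exists s1, [/\ dag Ax s1, below (m + j%:Z) \in s1
    & size s1 = j * size s + size s0].
Proof.
elim: j m s0 => [|j IH] m s0 ds0 ms0 AA ds Ts.
  by exists s0; rewrite addr0.
have e : (m + j.+1%:Z = m + 1 + j%:Z)%R by lia.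
have ds1 : dag Ax (map (lift m) s ++ s0).
  apply: dag_lift ds0 ms0 _ ds => T /AA[|h]; [by left | right].
  by move=> ab /h; lia.
have [||s1 [ds2 ms2 sz]] := IH (m + 1)%R _ ds1 _ _ ds Ts.
- by rewrite mem_cat -liftT map_f.
- by rewrite -e.
exists s1; split=> //; first by rewrite e.
by rewrite sz size_cat size_map; lia.
Qed.

End Lift.

(** Makes room in [(a + b) ^ k] for [2 ^ k - 1] copies of the smaller subtree and one of the larger;
    tight at [a = b]. *)
Lemma expn_add_ge a b k : a <= b -> 2 ^ k * a ^ k + b ^ k <= (a + b) ^ k + a ^ k.
Proof.
move=> ab; elim: k => [|k IH]; first by rewrite !expn0.
have h := leq_mul (leqnn (a + b)) IH.
have h' : a ^ k <= b ^ k by case: (k) => // j; rewrite leq_exp2r.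
have h2 := leq_mul (leqnn a) h'.
have h3 : a ^ k * (b - a) <= 2 ^ k * (a ^ k * (b - a)).
  by rewrite leq_pmull ?expn_gt0.
move: h2 h3 h; rewrite !expnS.
move: (2 ^ k) (a ^ k) (b ^ k) ((a + b) ^ k) => t x y z.
by move: ab => /subnK <-; rewrite addnK; move: (b - a) => d; nia.
Qed.

Section StabbingPlanes.
Variables (n : nat) (V : {set 'I_n}).
Let assignment := {ffun 'I_n -> bool}.
Implicit Types (e : 'rV[int]_n) (S : seq (ineq n)) (T : sp_tree n).
Local Open Scope ring_scope.

(** Both halves are given by full assignments, each read on one side of [V] only; this leaves
    proportions unchanged. *)
Definition mix (a b : assignment) : assignment :=
  [ffun i => if i \in V then a i else b i].
Definition dot e (x : assignment) : int := \sum_i e 0 i * (x i)%:Z.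
Definition dotX e (a : assignment) : int := \sum_(i in V) e 0 i * (a i)%:Z.
Definition dotY e (b : assignment) : int := \sum_(i | i \notin V) e 0 i * (b i)%:Z.

Definition viol (p : ineq n) := below (dotX p.1) (dotY p.1) p.2.
Definition viol_of S (T : {set assignment * assignment}) :=
  exists2 p, p \in S & T = viol p.

Lemma dot_mix e a b : dot e (mix a b) = dotX e a + dotY e b.
Proof.
rewrite /dot (bigID (mem V)) /=; congr (_ + _); apply: eq_bigr => i iV.
  by rewrite ffunE iV.
by rewrite ffunE (negbTE iV).
Qed.

Lemma dotXN e a : dotX (- e) a = - dotX e a.
Proof. by rewrite /dotX -sumrN; apply: eq_bigr => i _; rewrite mxE mulNr. Qed.

Lemma dotYN e a : dotY (- e) a = - dotY e a.
Proof. by rewrite /dotY -sumrN; apply: eq_bigr => i _; rewrite mxE mulNr. Qed.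

Lemma dot_bound e x (M : nat) : (forall i, `|e 0 i| <= M%:Z) ->
  `|dot e x| <= (n * M)%N%:Z.
Proof.
move=> h; apply: le_trans (ler_norm_sum _ _ _) _.
have : \sum_(i < n) `|e 0 i * (x i)%:Z| <= \sum_(i < n) M%:Z.
  apply: ler_sum => i _; rewrite normrM; apply: le_trans (h i).
  by case: (x i); rewrite ?normr1 ?normr0 ?mulr1 ?mulr0.
by rewrite sumr_const card_ord -mulr_natl natz PoszM.
Qed.

(** The lines are the partial sums of the combination. The empty sum is never negative, giving
    [set0]; the full one is identically [-1], giving [setT]. *)
Lemma farkas_dag S lam : farkas S lam ->
  exists s, [/\ dag (viol_of S) s, setT \in s & size s = (size S).+1].
Proof.
case=> sz /allP lam0 lin cst.
pose slack (q : seq (rat * ineq n)) (ab : assignment * assignment) : rat :=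
  \sum_(p <- q) p.1 * (dot p.2.1 (mix ab.1 ab.2) - p.2.2)%:~R.
suff main q : (forall p, p \in q -> 0 <= p.1 /\ p.2 \in S) ->
    exists s, [/\ dag (viol_of S) s, [set ab | slack q ab < 0] \in s
      & size s = (size q).+1].
  have [p pz|s [ds hs szs]] := main (zip lam S).
    split.
      by apply: lam0; rewrite -(@unzip1_zip _ _ lam S) ?sz //; exact: map_f.
    by rewrite -(@unzip2_zip _ _ lam S) ?sz //; exact: map_f.
  exists s; split=> //; last by rewrite szs size_zip sz minnn.
  suff <- : [set ab | slack (zip lam S) ab < 0] = setT by [].
  apply/setP=> ab; rewrite !inE /slack.
  have -> : \sum_(p <- zip lam S) p.1 * (dot p.2.1 (mix ab.1 ab.2) - p.2.2)%:~R =
      \sum_(p <- zip lam S) p.1 * (dot p.2.1 (mix ab.1 ab.2))%:~R - 1 :> rat.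
    by rewrite -[in X in _ - X]cst -sumrB; apply: eq_bigr => p _; rewrite rmorphB mulrBr.
  suff -> : \sum_(p <- zip lam S) p.1 * (dot p.2.1 (mix ab.1 ab.2))%:~R = 0 :> rat.
    by rewrite sub0r oppr_lt0 ltr01.
  transitivity (\sum_i (\sum_(p <- zip lam S) p.1 *: map_mx intr p.2.1) 0 i *
      (mix ab.1 ab.2 i)%:R : rat).
    under [RHS]eq_bigr do rewrite summxE big_distrl.
    rewrite exchange_big; apply: eq_bigr => p _.
    rewrite /dot rmorph_sum big_distrr; apply: eq_bigr => i _.
    by rewrite /= !mxE rmorphM mulrA.
  by rewrite lin big1 // => i _; rewrite mxE mul0r.
elim: q => [|p q IH] hq.
  exists [:: set0]; split=> //=; first by split=> //; [exact: triangle0 | left].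
  rewrite inE; apply/eqP/setP=> ab; rewrite !inE /slack big_nil.
  exact: ltxx.
have [|s [ds hs szs]] := IH.
  by move=> p' pq; apply: hq; rewrite inE pq orbT.
have [p0 pS] := hq p (mem_head _ _).
exists ([set ab | slack (p :: q) ab < 0] :: s); split=> //=.
- split=> //.
    pose F (r : seq (rat * ineq n)) a : rat :=
      \sum_(p <- r) p.1 * (dotX p.2.1 a - p.2.2)%:~R.
    pose G (r : seq (rat * ineq n)) b : rat :=
      \sum_(p <- r) p.1 * (dotY p.2.1 b)%:~R.
    suff -> : [set ab | slack (p :: q) ab < 0] =
        [set ab | F (p :: q) ab.1 + G (p :: q) ab.2 < 0].
      exact: triangle_sum.
    apply/setP=> ab; rewrite !inE /slack /F /G -big_split; congr (_ < _).
    apply: eq_bigr => r _; rewrite dot_mix /= -mulrDr -rmorphD /=.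
    by rewrite addrAC.
  right; exists (viol p.2), [set ab | slack q ab < 0]; split=> //.
    by left; exists p.2.
  apply/fintype.subsetP=> ab; rewrite !inE /slack big_cons -dot_mix => h.
  case: ltP => //= hp; have: 0 <= p.1 * (dot p.2.1 (mix ab.1 ab.2) - p.2.2)%:~R.
    by rewrite mulr_ge0 // ler0z subr_ge0.
  by move=> h'; apply: le_lt_trans h; rewrite lerDr.
- exact: mem_head.
- by rewrite szs.
Qed.

(* The derivation [ss] is used once for every value of [e x] below [b]: in
   [sp_dag] it comes from the smaller of the two subtrees, so that the size grows
   by a factor [2 ^ k] only when the number of leaves doubles. *)
Lemma query_dag S e (b : int) ss sl (L : nat) : `|b| <= L%:Z ->
  (forall x, `|dot e x| <= L%:Z) ->
  dag (viol_of ((- e, 1 - b) :: S)) ss -> setT \in ss ->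
  dag (viol_of ((e, b) :: S)) sl -> setT \in sl ->
  exists s, [/\ dag (viol_of S) s, setT \in s
    & (size s <= size sl + 2 * L * size ss + 1)%N].
Proof.
move=> bL eL dss Tss dsl Tsl.
(* The climb starts at [- L], where nothing is falsified, and reaches [b] in [j <= 2 * L] rounds. *)
have [j ej] : exists j : nat, b = - L%:Z + j%:Z.
  by exists (absz (b + L%:Z)); lia.
have below0 : below (dotX e) (dotY e) (- L%:Z) = set0.
  apply/setP=> -[x y]; rewrite !inE /= -dot_mix; apply/negbTE.
  by have := eL (mix x y); lia.
have ds0 : dag (viol_of S) [:: set0].
  by split=> //; [exact: triangle0 | left].
have [||s1 [ds1 bs1 sz1]] :=
    dag_climb (u := dotX e) (v := dotY e) (m := - L%:Z) (j := j) ds0 _ _ dss Tss.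
- by rewrite below0 mem_head.
- move=> T [p]; rewrite inE => /orP[/eqP -> -> |pS ->]; last by left; exists p.
  by right=> ab; rewrite !inE /= dotXN dotYN -ej; lia.
exists (sl ++ s1); split.
- apply: dag_cat ds1 bs1 _ dsl => T [p]; rewrite inE => /orP[/eqP -> ->|pS ->].
    by right; rewrite /viol ej.
  by left; exists p.
- by rewrite mem_cat Tsl.
- rewrite size_cat sz1 /= addnA leq_add2r leq_add2l leq_mul2r; apply/orP; right.
  by lia.
Qed.

(** [(sp_size T).+1] counts leaves, and [2 ^ k] covers the repetitions of the smaller subtree at a
    query, which [expn_add_ge] absorbs. *)
Lemma sp_dag S T (M k : nat) : sp_refutes S T ->
  {in sp_coefs T, forall z, `|z| <= M%:Z} -> (2 * (n.+1 * M) + 4 <= 2 ^ k)%N ->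
  exists s, [/\ dag (viol_of S) s, setT \in s
    & (size s <= (size S + sp_size T).+1 * (sp_size T).+1 ^ k)%N].
Proof.
move=> + + Mk; elim: T S => [lam|e b l IHl r IHr] S /=.
  move=> /farkas_dag[s [ds Ts sz]] _; exists s; split=> //.
  by rewrite exp1n muln1 sz addn0.
move=> [rl rr] hM.
(* The final successor leaves room for [1 - b] when the branches are swapped. *)
have bM : `|b| <= (n.+1 * M).+1%:Z.
  by have := hM b (mem_head _ _); nia.
have eM x : `|dot e x| <= (n.+1 * M).+1%:Z.
  suff : `|dot e x| <= (n * M)%N%:Z by nia.
  by apply: dot_bound => i; apply: hM; rewrite inE mem_cat map_f ?orbT ?mem_enum.
have [|sl [dl Tl szl]] := IHl _ rl.
  by move=> z zl; apply: hM; rewrite inE !mem_cat zl !orbT.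
have [|sr [dr Tr szr]] := IHr _ rr.
  by move=> z zl; apply: hM; rewrite inE !mem_cat zl !orbT.
move: szl szr => /=; set x := (sp_size l).+1; set y := (sp_size r).+1.
set W := (size S + (sp_size l + sp_size r).+1).+1 => szl szr.
have arith c d ss sd : (c <= d)%N -> (0 < c)%N -> (size ss <= W * c ^ k)%N ->
    (size sd <= W * d ^ k)%N -> forall s : seq {set assignment * assignment},
    (size s <= size sd + 2 * (n.+1 * M).+1 * size ss + 1)%N ->
    (size s <= W * (c + d) ^ k)%N.
  move=> cd c0 hss hsd s hs; have h := expn_add_ge k cd.
  have p0 : (0 < c ^ k)%N by rewrite expn_gt0 c0.
  have hK : ((2 * (n.+1 * M).+1 + 2) * c ^ k <= 2 ^ k * c ^ k)%N.
    by rewrite leq_mul2r; apply/orP; right; apply: leq_trans Mk; lia.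
  have hz : (d ^ k + (2 * (n.+1 * M).+1 + 1) * c ^ k <= (c + d) ^ k)%N by lia.
  apply: leq_trans (leq_mul (leqnn W) hz); apply: leq_trans hs _.
  have hss' := leq_mul (leqnn (2 * (n.+1 * M).+1)) hss.
  have W0 : (0 < W * c ^ k)%N by rewrite muln_gt0 p0.
  move: hss' hsd W0; rewrite mulnDr mulnDl mul1n mulnDr (mulnCA W).
  move: (W * c ^ k)%N (W * d ^ k)%N (2 * _ * _)%N => x' y' z'.
  move: (2 * _ * _)%N (size sd) => t u; lia.
have wl : (size sl <= W * x ^ k)%N.
  by apply: leq_trans szl _; rewrite leq_mul2r /W; lia.
have wr : (size sr <= W * y ^ k)%N.
  by apply: leq_trans szr _; rewrite leq_mul2r /W; lia.
have -> : (sp_size l + sp_size r).+2 = (x + y)%N by lia.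
case/orP: (leq_total x y) => xy.
  have [s [ds Ts szs]] := query_dag bM eM dl Tl dr Tr.
  by exists s; split=> //; apply: arith szs.
(* Here the right subtree is the smaller one, so the query is read backwards, as [- e] and
   [1 - b]. *)
have eM' z : `|dot (- e) z| <= (n.+1 * M).+1%:Z.
  rewrite (_ : dot (- e) z = - dot e z) ?normrN //.
  by rewrite /dot -sumrN; apply: eq_bigr => i _; rewrite mxE mulNr.
have [||s [ds Ts szs]] := query_dag (S := S) (e := - e) (b := 1 - b)
    (ss := sr) (sl := sl) (L := (n.+1 * M).+1) _ eM' _ Tr dl Tl.
- have : `|b| <= M%:Z := hM b (mem_head _ _).
  by lia.
- by rewrite opprK opprB addrCA subrr addr0.
exists s; split=> //; rewrite addnC; exact: arith szs.
Qed.

End StabbingPlanes.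

(** * Covering sign patterns and expanding hypergraphs *)

Section Formula.
Variable n : nat.
Let assignment := {ffun 'I_n -> bool}.
Implicit Types (Z C : {set 'I_n}) (x y : assignment).

Definition agree Z x y := [forall t in Z, x t == y t].

Lemma agreeP Z x y : reflect {in Z, x =1 y} (agree Z x y).
Proof. by apply: (iffP forall_inP) => h t /h/eqP. Qed.

(** Flipping the coordinates in the subsets of [C] yields [2 ^ #|C|] disjoint copies of [Q]. *)
Lemma card_forced (Q : {set assignment}) C :
  {in Q &, forall x y, agree C x y} -> #|Q| * 2 ^ #|C| <= 2 ^ n.
Proof.
move=> hQ; rewrite -card_powerset -cardsX.
have -> : 2 ^ n = #|{: assignment}| by rewrite card_ffun card_bool card_ord.
pose flip (u : assignment * {set 'I_n}) : assignment :=
  [ffun t => u.1 t (+) (t \in u.2)].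
apply: leq_trans (max_card [in flip @: setX Q (powerset C)]).
rewrite card_in_imset // => -[x D] [y D'].
rewrite !inE /= => /andP[xQ DC] /andP[yQ D'C] /ffunP e.
have eD : D = D'.
  apply/setP=> t; have := e t; rewrite !ffunE /=.
  case: (boolP (t \in C)) => tC.
    by rewrite (agreeP _ _ _ (hQ _ _ xQ yQ)) // => /addbI.
  have out (F : {set 'I_n}) : F \subset C -> (t \in F) = false.
    by move=> FC; apply: contraNF tC; exact: (fintype.subsetP FC).
  by rewrite !out.
congr (_, _) => //; apply/ffunP=> t; have := e t.
by rewrite !ffunE /= eD => /addIb.
Qed.

Lemma popular_pattern (Z : {set 'I_n}) (S : {set assignment}) d : #|Z| <= d ->
  exists y, #|S| <= 2 ^ d * #|[set x in S | agree Z x y]|.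
Proof.
move=> Zd; pose c y := #|[set x in S | agree Z x y]|.
pose y0 : assignment := [ffun=> false].
have [y _ ymax] : exists2 y, true & forall z, c z <= c y.
  by case: (@arg_maxnP _ y0 xpredT c) => // y _ h; exists y => // z; exact: h.
exists y; pose pat (Q : {set 'I_n}) : assignment := [ffun t => t \in Q].
have : #|S| <= \sum_(Q in powerset Z) c (pat Q).
  have sub : S \subset
      \bigcup_(Q in powerset Z) [set x in S | agree Z x (pat Q)].
    apply/fintype.subsetP=> x xS; apply/bigcupP; exists [set t in Z | x t].
      by rewrite inE; apply/fintype.subsetP=> t; rewrite inE => /andP[].
    by rewrite inE xS; apply/agreeP=> t tZ; rewrite ffunE inE tZ.
  apply: leq_trans (subset_leq_card sub) _.
  elim/big_rec2: _ => [|Q k T _ IH]; first by rewrite cards0.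
  by rewrite (leq_trans (leq_card_setU _ _)) // leq_add.
move/leq_trans; apply.
apply: (@leq_trans (\sum_(Q in powerset Z) c y)).
  by apply: leq_sum => Q _; exact: ymax.
by rewrite sum_nat_const card_powerset leq_mul2r leq_pexp2l // orbT.
Qed.

(** Each new pattern is the most frequent one among the surviving assignments, so at least a
    [2 ^ - d] fraction of them is removed. *)
Lemma greedy_signs (Z : nat -> {set 'I_n}) d : (forall i, #|Z i| <= d) ->
  forall m, exists sigma : nat -> assignment,
    #|[set x | [forall i : 'I_m, ~~ agree (Z i) x (sigma i)]]| * (2 ^ d) ^ m
      <= 2 ^ n * (2 ^ d).-1 ^ m.
Proof.
move=> Zd; elim=> [|m [sigma IH]].
  exists (fun=> [ffun=> false]); rewrite !expn0 !muln1.
  by rewrite -[2 in leqRHS]card_bool -[n in leqRHS]card_ord -card_ffun max_card.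
move: IH; set S := [set x | _] => IH.
have [y hy] := popular_pattern S (Zd m).
exists (fun i => if i == m then y else sigma i).
set S' := [set x | _].
have eS : #|S| = #|[set x in S | agree (Z m) x y]| + #|S'|.
  rewrite -(cardsID [set x | agree (Z m) x y] S); congr (_ + _).
    by apply: eq_card => x; rewrite !inE.
  apply: eq_card => x; rewrite !inE; apply/andP/forallP => [[h1 /forallP h2] i|h].
    rewrite /=; case: eqP => [->//|/eqP im].
    have im' : i < m by rewrite ltn_neqAle im -ltnS ltn_ord.
    exact: (h2 (Ordinal im')).
  split; first by have := h ord_max; rewrite /= eqxx.
  apply/forallP=> i; have := h (widen_ord (leqnSn m) i).
  by rewrite /= ltn_eqF.
rewrite !expnS.
have : #|S'| * 2 ^ d <= #|S| * (2 ^ d).-1.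
  move: hy; rewrite eS; move: (expn_gt0 2 d) => /=.
  by case: (2 ^ d) => // t _; move: #|_| #|_| => p q /=; nia.
move: IH; move: ((2 ^ d) ^ m) ((2 ^ d).-1 ^ m) #|S| #|S'| => D D1 s s'.
move: (2 ^ d) (2 ^ d).-1 (2 ^ n) => e e1 t h1 h2.
rewrite mulnA; apply: leq_trans (leq_mul h2 (leqnn D)) _.
rewrite mulnAC; apply: leq_trans (leq_mul h1 (leqnn e1)) _.
by rewrite -mulnA (mulnC D1).
Qed.

Lemma pred_expn_half D : 0 < D -> 2 * D.-1 ^ D <= D ^ D.
Proof.
case: D => // E _ /=.
(* Bernoulli's inequality [(1 + 1 / E) ^ k >= 1 + k / E], used at [k = E + 1]. *)
have bern k : E ^ k * (E + k) <= E * E.+1 ^ k.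
  elim: k => [|k IH]; first by rewrite !expn0 addn0 mul1n muln1.
  rewrite !expnS; move: (E ^ k) (E.+1 ^ k) IH => x y IH; nia.
have [->|E0] := posnP E; first by rewrite exp0n.
by rewrite -(leq_pmul2l E0); apply: leq_trans (bern _); nia.
Qed.

(** Every [2 ^ d] greedy rounds at least halve the survivors, so [n + 1] such blocks leave fewer
    than one. *)
Lemma covering_signs (Z : nat -> {set 'I_n}) d : (forall i, #|Z i| <= d) ->
  exists sigma : nat -> assignment, forall x,
    exists i : 'I_(2 ^ d * n.+1), agree (Z i) x (sigma i).
Proof.
move=> Zd; set m := 2 ^ d * n.+1; have [sigma h] := greedy_signs Zd m.
exists sigma => x; apply/existsP; rewrite -[X in is_true X]negbK negb_exists.
apply/negP=> hx; move: h; set S := [set _ | _].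
have S0 : 0 < #|S| by apply/card_gt0P; exists x; rewrite inE.
have D0 : 0 < 2 ^ d by rewrite expn_gt0.
have : 2 ^ n.+1 * (2 ^ d).-1 ^ m <= (2 ^ d) ^ m.
  by rewrite /m !expnM -expnMn leq_exp2r // pred_expn_half.
have Dm : 0 < (2 ^ d) ^ m by rewrite expn_gt0 D0.
by rewrite expnS; move: #|S| S0 ((2 ^ d) ^ m) Dm => *; nia.
Qed.

Definition clause_of Z y : clause n := ([set t in Z | ~~ y t], [set t in Z | y t]).

Lemma clause_sat_of Z x y : clause_sat x (clause_of Z y) = ~~ agree Z x y.
Proof.
apply/idP/idP.
  case/orP=> /exists_inP[t]; rewrite inE => /andP[tZ yt] xt.
    by apply/negP=> /agreeP/(_ t tZ); rewrite xt (negbTE yt).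
  by apply/negP=> /agreeP/(_ t tZ); rewrite (negbTE xt) yt.
rewrite negb_forall_in => /exists_inP[t tZ xy]; apply/orP.
case: (boolP (y t)) xy => yt xt; [right | left]; apply/exists_inP; exists t.
- by rewrite inE tZ yt.
- by move: xt; case: (x t).
- by rewrite inE tZ yt.
- by move: xt; case: (x t).
Qed.

Local Open Scope ring_scope.

Lemma dot_clause (c : clause n) x : clause_sat x c ->
  (clause_ineq c).2 <= dot (clause_ineq c).1 x.
Proof.
move=> xc; have := clause_ineqE c (fun i => (x i)%:Z : int).
under [X in _ <= X]eq_bigr do rewrite intz; rewrite intz => ->.
have ge0 t : 0 <= (x t)%:Z :> int by [].
have ge0' t : 0 <= 1 - (x t)%:Z :> int by case: (x t).
case/orP: xc => /exists_inP[t tc xt].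
  rewrite (bigD1 t) //= xt -addrA lerDl addr_ge0 ?sumr_ge0 //.
rewrite addrC (bigD1 t tc) /= (negbTE xt) subr0 -addrA lerDl addr_ge0 ?sumr_ge0 //.
Qed.

Lemma dot_delta i x : dot (delta_mx 0 i) x = (x i)%:Z.
Proof.
rewrite /dot (bigD1 i) //= big1 => [|j ji]; first by rewrite mxE !eqxx mul1r addr0.
by rewrite mxE eqxx (negbTE ji) mul0r.
Qed.

End Formula.

Lemma card_family_prod (aT rT : finType) (F : aT -> pred rT) :
  #|(family F : pred {ffun aT -> rT})| = \prod_x #|F x|.
Proof. by rewrite card_family foldrE big_image. Qed.

(** Vertices form [w] groups of size [N], and edge [i] picks one vertex in each group. Edges are
    thus arbitrary functions, easy to count, with exactly [w] vertices each. *)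
Definition hcover m w N (h : {ffun 'I_m -> {ffun 'I_w -> 'I_N}}) (E : {set 'I_m}) :
  {set 'I_w * 'I_N} := [set p | [exists i in E, h i p.1 == p.2]].

Lemma leq_bin_expn m r : 'C(m, r) <= m ^ r.
Proof.
apply: (@leq_trans (m ^_ r)); first by rewrite -bin_ffact leq_pmulr ?fact_gt0.
elim: r => [|r IH]; first by rewrite ffactn0.
by rewrite ffactnSr expnSr leq_mul // leq_subr.
Qed.

(* Union bound over the edge set [E] and over an enumeration [phi] of the
   vertices that it covers. *)
Lemma expander_exists m w N r v : 0 < w -> 0 < N -> r <= m ->
  m ^ r * (w * N) ^ v * v ^ (w * r) < N ^ (w * r) ->
  exists h : {ffun 'I_m -> {ffun 'I_w -> 'I_N}},
    forall E : {set 'I_m}, #|E| = r -> v < #|hcover h E|.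
Proof.
move=> w0 N0 rm lt.
pose inside (phi : {ffun 'I_v -> 'I_w * 'I_N}) (g : {ffun 'I_w -> 'I_N}) :=
  [forall j, (j, g j) \in codom phi].
pose bad (E : {set 'I_m}) phi := [set h : {ffun 'I_m -> {ffun 'I_w -> 'I_N}} |
  [forall i in E, inside phi (h i)]].
have card_inside phi : #|[pred g | inside phi g]| <= v ^ w.
  have -> : #|[pred g | inside phi g]| =
      #|(family (fun j => [pred x | (j, x) \in codom phi])
         : pred {ffun 'I_w -> 'I_N})|.
    by apply: eq_card => g; rewrite !inE; apply: eq_forallb => j; rewrite ?inE.
  rewrite card_family_prod -[w in leqRHS]card_ord -prod_nat_const.
  apply: leq_prod => j _.
  rewrite -(card_imset _ (f := pair j)); last by move=> ? ? [].
  apply: (@leq_trans #|codom phi|).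
    apply: subset_leq_card; apply/fintype.subsetP=> p /imsetP[x]; rewrite inE.
    by move=> h ->.
  by rewrite -[v in leqRHS]card_ord leq_image_card.
have card_bad (E : {set 'I_m}) phi : #|E| = r ->
    #|bad E phi| <= (v ^ w) ^ r * (N ^ w) ^ (m - r).
  move=> Er.
  have -> : #|bad E phi| =
      #|(family (fun i => [pred g | (i \in E) ==> inside phi g])
         : pred {ffun 'I_m -> {ffun 'I_w -> 'I_N}})|.
    by apply: eq_card => h; rewrite !inE; apply: eq_forallb => i; rewrite ?inE.
  rewrite card_family_prod (bigID (mem E)) /=; apply: leq_mul.
    rewrite -Er -prod_nat_const; apply: leq_prod => i iE.
    apply: leq_trans (card_inside phi); apply: subset_leq_card.
    by apply/fintype.subsetP=> g; rewrite !inE iE.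
  have -> : m - r = #|[pred i | i \notin E]|.
    have := cardC (mem E); rewrite card_ord Er.
    have -> : #|[predC (mem E)]| = #|[pred i | i \notin E]| by exact: eq_card.
    lia.
  rewrite -prod_nat_const; apply: leq_prod => i iE.
  by rewrite (leq_trans (max_card _)) // card_ffun !card_ord.
have [h hP] : exists h, forall (E : {set 'I_m}) phi, #|E| = r -> h \notin bad E phi.
  apply: contrapT => no.
  have : #|{: {ffun 'I_m -> {ffun 'I_w -> 'I_N}}}| <=
      \sum_(E : {set 'I_m} | #|E| == r) \sum_(phi : {ffun 'I_v -> 'I_w * 'I_N})
        (v ^ w) ^ r * (N ^ w) ^ (m - r).
    have sub : [set: {ffun 'I_m -> {ffun 'I_w -> 'I_N}}] \subset
        \bigcup_(E : {set 'I_m} | #|E| == r)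
          \bigcup_(phi : {ffun 'I_v -> 'I_w * 'I_N}) bad E phi.
      apply/fintype.subsetP=> h _; apply: contrapT => hb; apply: no; exists h.
      move=> E phi /eqP Er; apply/negP=> hE; apply: hb.
      by apply/bigcupP; exists E => //; apply/bigcupP; exists phi.
    rewrite -cardsT; apply: leq_trans (subset_leq_card sub) _.
    elim/big_rec2: _ => [|E k T /eqP Er IH]; first by rewrite cards0.
    rewrite (leq_trans (leq_card_setU _ _)) // leq_add //.
    elim/big_rec2: _ => [|phi k' T' _ IH']; first by rewrite cards0.
    by rewrite (leq_trans (leq_card_setU _ _)) // leq_add // card_bad.
  rewrite !sum_nat_const.
  rewrite (_ : #|[pred E : {set 'I_m} | #|E| == r]| = 'C(m, r)); last first.
    by have := card_draws 'I_m r; rewrite cardsE card_ord.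
  rewrite !card_ffun card_prod !card_ord leqNgt => /negP; apply.
  rewrite -[X in _ < _ ^ X](subnKC rm) expnD !mulnA.
  rewrite ltn_pmul2r; last by rewrite !expn_gt0 N0.
  rewrite -!expnM; apply: leq_ltn_trans lt.
  by rewrite !leq_mul2r leq_bin_expn !orbT.
exists h => E Er; rewrite ltnNge; apply/negP=> small.
(* [p0] pads the enumeration when fewer than [v] vertices are covered. *)
pose p0 := (Ordinal w0, Ordinal N0).
pose phi : {ffun 'I_v -> 'I_w * 'I_N} :=
  [ffun i : 'I_v => nth p0 (enum (hcover h E)) i].
have := hP E phi Er; rewrite inE => /negP; apply.
apply/forall_inP=> i iE; apply/forallP=> j.
have hj : (j, h i j) \in hcover h E by rewrite inE; apply/exists_inP; exists i => /=.
have lt' : index (j, h i j) (enum (hcover h E)) < v.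
  by rewrite (leq_trans _ small) // cardE index_mem mem_enum.
by apply/codomP; exists (Ordinal lt'); rewrite ffunE /= nth_index // mem_enum.
Qed.

(** * The hard formulas *)

(** Each vertex carries one variable in [V] and one outside, and clause [i] uses both copies of edge
    [i]. On either half, falsifying [k + 1] clauses fixes more than [v] variables and falsifying one
    fixes [w]; this gives the probabilities needed by [dag_size]. *)
Lemma hard_cnf n w N k v : let m := 2 ^ w.*2 * n.+1 in
  0 < w -> 0 < N -> 0 < k -> (w * N).*2 <= n -> k < m ->
  m ^ k.+1 * (w * N) ^ v * v ^ (w * k.+1) < N ^ (w * k.+1) ->
  4 * k <= 2 ^ w -> (4 * k) ^ k.+1 <= 2 ^ v ->
  exists F : cnf n, [/\ unsat F, size F = m &
    forall (T : sp_tree n) (M kappa : nat), sp_refutation F T ->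
      {in sp_coefs T, forall z : int, (`|z| <= M%:Z)%R} ->
      2 * (n.+1 * M) + 4 <= 2 ^ kappa ->
      2 ^ k <= (m + n.*2 + sp_size T).+1 * (sp_size T).+1 ^ kappa].
Proof.
move=> m w0 N0 k0 wNn km lt kw kv.
have [h hE] := expander_exists w0 N0 km lt.
pose vertex := (bool * ('I_w * 'I_N))%type.
have Hn : #|{: vertex}| <= n by rewrite !card_prod card_bool !card_ord mul2n.
pose pos (u : vertex) : 'I_n := widen_ord Hn (enum_rank u).
have pos_inj : injective pos.
  by move=> u u' /(congr1 val) /= /val_inj/enum_rank_inj.
pose V := [set pos (true, p) | p : 'I_w * 'I_N].
have posV s p : (pos (s, p) \in V) = s.
  apply/imsetP/idP => [[q _ /pos_inj[-> //]]|->]; by exists p.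
pose Z (i : 'I_m) := [set pos (u.1, (u.2, h i u.2)) | u : bool * 'I_w].
have Zc i : #|Z i| <= w.*2.
  by rewrite (leq_trans (leq_imset_card _ _)) // card_prod card_bool card_ord mul2n.
have [sigma cov] : exists sigma : 'I_m -> {ffun 'I_n -> bool},
    forall x, exists i, agree (Z i) x (sigma i).
  (* [covering_signs] expects a sequence over all naturals, so the edges are continued by empty
     sets. *)
  pose Z' j := if insub j is Some i then Z i else set0.
  have Z'c j : #|Z' j| <= w.*2.
    by rewrite /Z'; case: insub => [i|]; rewrite ?cards0.
  have [sigma cov] := covering_signs Z'c.
  exists (fun i => sigma i) => x; have [i] := cov x.
  by exists i; move: p; rewrite /Z' valK.
pose F := [seq clause_of (Z i) (sigma i) | i <- enum 'I_m].
pose U (a : {ffun 'I_n -> bool}) := [set i | agree (Z i :&: V) a (sigma i)].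
pose W (b : {ffun 'I_n -> bool}) := [set i | agree (Z i :\: V) b (sigma i)].
have pos_cover s (E : {set 'I_m}) p : p \in hcover h E ->
    exists2 i, i \in E & pos (s, p) \in Z i.
  rewrite inE => /exists_inP[i iE /eqP e]; exists i => //.
  by apply/imsetP; exists (s, p.1); rewrite //= e -surjective_pairing.
have small s (P : 'I_m -> {set 'I_n}) (E : {set 'I_m}) l :
    (forall i p, pos (s, p) \in Z i -> pos (s, p) \in P i) -> l <= #|hcover h E| ->
    #|[set x | E \subset [set i | agree (P i) x (sigma i)]]| * 2 ^ l <= 2 ^ n.
  move=> PZ El; pose C := [set pos (s, p) | p in hcover h E].
  have Cc : #|C| = #|hcover h E| by apply: card_imset => p q /pos_inj[].
  have forced : {in [set x | E \subset [set i | agree (P i) x (sigma i)]] &,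
      forall x y, agree C x y}.
    move=> x y; rewrite !inE => /fintype.subsetP Ex /fintype.subsetP Ey.
    apply/agreeP=> _ /imsetP[p /(pos_cover s)[i iE iZ] ->].
    have := Ex i iE; rewrite inE => /agreeP -> //; last exact: PZ.
    by have := Ey i iE; rewrite inE => /agreeP -> //; exact: PZ.
  apply: leq_trans (card_forced forced).
  by rewrite leq_mul2l leq_pexp2l ?Cc ?orbT.
have card_x : #|{: {ffun 'I_n -> bool}}| = 2 ^ n by rewrite card_ffun card_bool card_ord.
have inX i p : pos (true, p) \in Z i -> pos (true, p) \in Z i :&: V.
  by move=> iZ; rewrite inE iZ posV.
have inY i p : pos (false, p) \in Z i -> pos (false, p) \in Z i :\: V.
  by move=> iZ; rewrite inE iZ posV.
exists F; split.
- move=> x; have [i xi] := cov [ffun t => x t].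
  apply/allPn; exists (clause_of (Z i) (sigma i)).
    by apply: map_f; rewrite mem_enum.
  have := clause_sat_of (Z i) [ffun t => x t] (sigma i); rewrite xi /clause_sat /=.
  move/negbT; apply: contra => /orP[] /exists_inP[t tc xt]; apply/orP; [left|right];
    by apply/exists_inP; exists t => //; rewrite ffunE.
- by rewrite size_map; exact: size_enum_ord.
move=> T M kappa rT bT hk; have [s [ds Ts szs]] := sp_dag V rT bT hk.
have szS : size (encoding F) = m + n.*2.
  rewrite !size_cat 4!size_map -addnn; congr (_ + (_ + _)); exact: size_enum_ord.
rewrite szS in szs; apply: leq_trans szs; apply: (dag_size (U := U) (W := W)) ds Ts => //.
- by rewrite card_x expn_gt0.
- by rewrite card_x expn_gt0.
- move=> _ [p pS ->]; split; first exact: triangle_sum.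
  move: pS; rewrite !mem_cat => /orP[/mapP[c /mapP[i _ ->] ->]|pS].
    right; exists i => a b; rewrite inE /= -dot_mix => vio.
    have : agree (Z i) (mix V a b) (sigma i).
      rewrite -[agree _ _ _]negbK -clause_sat_of; apply/negP=> /dot_clause.
      by rewrite leNgt vio.
    move=> /agreeP ag; split; rewrite inE; apply/agreeP=> t; rewrite inE.
      by move=> /andP[/ag <- tV]; rewrite ffunE tV.
    by move=> /andP[tV /ag <-]; rewrite ffunE (negbTE tV).
  (* No Boolean assignment violates the bounds [0 <= x_i <= 1]. *)
  left; apply/setP=> -[a b]; rewrite inE /= -dot_mix inE.
  case/orP: pS => /mapP[i _ ->] /=; first by rewrite dot_delta.
  rewrite (_ : dot _ _ = - (mix V a b i)%:Z)%R; first by case: (mix _ _ _ _).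
  by rewrite -dot_delta /dot -sumrN; apply: eq_bigr => j _; rewrite mxE mulNr.
- move=> E Er; rewrite card_x; apply: leq_trans (small true _ E v inX _).
    by rewrite leq_mul2l kv orbT.
  by rewrite ltnW // hE.
- move=> E Er; rewrite card_x; apply: leq_trans (small false _ E v inY _).
    by rewrite leq_mul2l kv orbT.
  by rewrite ltnW // hE.
- move=> i; rewrite card_x; apply: leq_trans (small true _ [set i] w inX _).
    rewrite leq_mul // subset_leq_card //; apply/fintype.subsetP=> a.
    by rewrite !inE sub1set inE.
  have hw : #|[set (j, h i j) | j : 'I_w]| = w.
    by rewrite card_imset ?card_ord // => j j' [].
  rewrite -[leqLHS]hw; apply: subset_leq_card; apply/fintype.subsetP=> _ /imsetP[j _ ->].
  by rewrite inE; apply/exists_inP; exists i; rewrite ?inE.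
Qed.

(** * Choice of the parameters *)

Lemma leq_linear_expn l : 5 <= l -> 4 * (l + 2) <= 2 ^ l.
Proof.
elim: l => // l IH; rewrite leq_eqVlt => /orP[/eqP <- //|/IH].
by rewrite expnS; lia.
Qed.

(** [v] is chosen so that [2 ^ v = (4 k) ^ (k + 1)], and [w = 4 (l + 2)] makes [N ^ w] dominate the
    union bound for expansion. *)
Lemma hard_cnf_expn n l : 5 <= l -> 2 ^ (6 * l) <= n -> n < 2 ^ (6 * l + 6) ->
  exists F : cnf n, [/\ unsat F, size F <= n ^ 4 &
    forall (T : sp_tree n) (M kappa : nat), sp_refutation F T ->
      {in sp_coefs T, forall z : int, (`|z| <= M%:Z)%R} ->
      2 * (n.+1 * M) + 4 <= 2 ^ kappa ->
      2 ^ 2 ^ l <= 2 ^ (14 * l + 23) * (sp_size T).+1 ^ kappa.+1].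
Proof.
move=> l5 nl nu; pose lam := l + 2; pose w := 4 * lam; pose k := 2 ^ l.
pose N := 2 ^ (4 * l); pose v := lam * k.+1; pose m := 2 ^ w.*2 * n.+1.
have wk : w <= 2 ^ l by exact: leq_linear_expn.
have k32 : 32 <= k by rewrite /k -[32]/(2 ^ 5) leq_pexp2l.
have mU : m <= 2 ^ (14 * l + 22).
  have -> : 14 * l + 22 = w.*2 + (6 * l + 6) by rewrite /w /lam; lia.
  by rewrite expnD leq_mul2l nu orbT.
have wN : w * N <= 2 ^ (5 * l).
  have -> : 5 * l = l + 4 * l by lia.
  by rewrite expnD leq_mul2r wk orbT.
have vU : v <= 2 ^ (2 * l).
  rewrite mul2n -addnn expnD -/k -(@leq_pmul2l 4) // /v [leqLHS]mulnA -/w.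
  by apply: leq_trans (leq_mul wk (leqnn _)) _; rewrite -/k;
    move: (k) k32 => x x32; nia.
have h4k : 4 * k = 2 ^ lam by rewrite /k /lam expnD mulnC.
have [||||||||F [uF sF hF]] := @hard_cnf n w N k v.
- by rewrite /w /lam; lia.
- by rewrite expn_gt0.
- by rewrite expn_gt0.
- apply: leq_trans nl; rewrite -mul2n; apply: leq_trans (leq_mul (leqnn 2) wN) _.
  by rewrite -expnS leq_pexp2l //; lia.
- apply: (@leq_trans (2 ^ w.*2)); last by rewrite leq_pmulr.
  by rewrite ltn_exp2l // /w /lam; lia.
- rewrite -/m.
  have h1 : m ^ k.+1 <= 2 ^ ((14 * l + 22) * k.+1) by rewrite expnM leq_exp2r.
  have v0 : 0 < v by rewrite /v /lam; lia.
  have h2 : (w * N) ^ v <= 2 ^ (5 * l * v) by rewrite expnM leq_exp2r.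
  have h3 : v ^ (w * k.+1) <= 2 ^ (2 * l * (w * k.+1)).
    by rewrite [leqRHS]expnM leq_exp2r // /w /lam; lia.
  apply: leq_ltn_trans (leq_mul (leq_mul h1 h2) h3) _.
  rewrite -!expnD -expnM ltn_exp2l // /v /w /lam.
  move: k.+1 (ltn0Sn k) => r r0.
  have -> : 4 * l * (4 * (l + 2) * r) = (16 * l * (l + 2)) * r by ring.
  have -> : (14 * l + 22) * r + 5 * l * ((l + 2) * r) + 2 * l * (4 * (l + 2) * r) =
    (14 * l + 22 + 13 * l * (l + 2)) * r by ring.
  (* What remains is [14 l + 22 < 3 l (l + 2)], true from [l = 5] on. *)
  by rewrite ltn_pmul2r //; clear -l5; have := leq_mul l5 (leqnn l); lia.
- by rewrite h4k leq_pexp2l // /w; lia.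
- by rewrite h4k -expnM.
exists F; split=> //.
  rewrite sF; apply: leq_trans mU _; apply: (@leq_trans ((2 ^ (6 * l)) ^ 4)).
    by rewrite -expnM leq_pexp2l //; lia.
  by rewrite leq_exp2r.
move=> T M kappa rT bT hk; apply: leq_trans (hF T M kappa rT bT hk) _.
rewrite expnS mulnA leq_mul2r; apply/orP; right.
have h : (m + n.*2).+1 <= 2 ^ (14 * l + 23).
  have : n.*2.+1 <= 2 ^ (14 * l + 22).
    apply: (@leq_trans (2 ^ (6 * l + 6)).*2); first by lia.
    by rewrite -mul2n -expnS leq_pexp2l //; lia.
  by rewrite (addnS _ 22) expnS; lia.
by apply: leq_trans (leq_mul h (leqnn _)); rewrite mulnS; nia.
Qed.

(** For [y = u %/ (2 * d)] both [2 d C] and [y + 1] are at most [2 ^ y], which bounds the left side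
    by [2 ^ (2 d y)]. *)
Lemma poly_le_expn C d : exists u0, forall u, u0 <= u -> (C * u.+1) ^ d <= 2 ^ u.
Proof.
have [->|d0] := posnP d; first by exists 0 => u _; rewrite expn_gt0.
exists (2 * d * (2 * d * C)) => u hu; pose y := u %/ (2 * d).
have Cy : 2 * d * C <= y by rewrite leq_divRL ?muln_gt0 // mulnC.
have uy : u.+1 <= 2 * d * y.+1.
  by rewrite mulnC; apply: ltn_ceil; rewrite muln_gt0.
have yy : y.+1 <= 2 ^ y by exact: ltn_expl.
apply: (@leq_trans ((2 ^ y * 2 ^ y) ^ d)).
  rewrite leq_exp2r //; apply: leq_trans (leq_mul (leqnn C) uy) _.
  rewrite mulnA; apply: leq_mul => //; rewrite mulnC.
  by apply: leq_trans Cy _; apply: ltnW.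
rewrite -expnD addnn -expnM leq_pexp2l // -mul2n mulnAC mulnC.
exact: leq_trunc_div.
Qed.

(** These exponents contradict [hard_cnf_expn] for a tree of size below [2 ^ 2 ^ u],
    [u = l %/ 4 + 1]. The polynomial factors are at most [2 ^ u], so the sum is at most
    [2 ^ (2 u + 1)], with [u] only about [l / 4]. *)
Lemma final_growth c : exists l0, forall l, l0 <= l ->
  14 * l + 23 + 2 ^ (l %/ 4).+1 * ((6 * l + 6) + 4 + (6 * l + 6) ^ c.+1) < 2 ^ l.
Proof.
have [u0 hu] := poly_le_expn 30 c.+2.
exists (4 * u0 + 16) => l hl; set q := 6 * l + 6; set u := (l %/ 4).+1.
have [lu1 lu2] : l < 4 * u /\ 4 * u <= l + 4 by rewrite /u; lia.
have {}hu := hu u ltac:(lia); set X := 30 * u.+1 in hu.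
have qX : q + 4 <= X by rewrite /q /X; lia.
have X1 : 2 <= X by rewrite /X; lia.
have h1 : q ^ c.+1 <= X ^ c.+1 by rewrite leq_exp2r //; lia.
have h2 : X <= X ^ c.+1 by rewrite -[leqLHS]expn1 leq_pexp2l //; lia.
have h3 : 2 * X ^ c.+1 <= X ^ c.+2 by rewrite [leqRHS]expnS leq_mul2r X1 orbT.
have h4 : 14 * l + 23 <= X ^ c.+2 by rewrite /X in h2 h3 *; lia.
have hu2 : 0 < 2 ^ u by rewrite expn_gt0.
apply: (@leq_ltn_trans (X ^ c.+2 + 2 ^ u * X ^ c.+2)).
  by rewrite leq_add // leq_mul2l; apply/orP; right; lia.
apply: (@leq_ltn_trans (2 ^ (u.*2.+1))).
  rewrite [leqRHS]expnS -addnn expnD.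
  by move: (2 ^ u) (X ^ c.+2) hu hu2 => x y; clear; nia.
by rewrite ltn_exp2l //; lia.
Qed.

Local Open Scope ring_scope.

Lemma quasipoly_le (R : realType) c n q : (0 < n)%N -> (n <= 2 ^ q)%N ->
  quasipoly R c n <= (2 ^ q ^ c.+1)%N%:R.
Proof.
move=> n0 nq; have ln2 : 0 < ln 2 :> R by rewrite ln_gt0 // ltr1n.
have n1 : 1 <= n%:R :> R by rewrite ler1n.
have log_le : ln (n%:R : R) / ln 2 <= q%:R.
  rewrite ler_pdivrMr // mulr_natl -lnXn // ler_ln ?posrE ?ltr0n //.
  by rewrite -natrX ler_nat.
have log_ge0 : 0 <= ln (n%:R : R) / ln 2 by apply: divr_ge0;
  [exact: ln_ge0 | exact: ltW].
rewrite /quasipoly; apply: (@le_trans _ _ (n%:R `^ (q ^ c)%N%:R)).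
  by apply: ler_powR => //; rewrite natrX lerXn2r ?nnegrE // ler0n.
rewrite powR_mulrn ?ler0n // -natrX ler_nat expnS.
by case: (posnP (q ^ c)) => [->|qc]; rewrite ?muln0 // expnM leq_exp2r.
Qed.

Lemma powR_pow2_le (R : realType) n q u (d : nat) : (0 < d)%N -> (n <= 2 ^ q)%N ->
  (q <= d * u)%N -> 2 `^ (n%:R `^ d%:R^-1) <= (2 ^ 2 ^ u)%N%:R :> R.
Proof.
move=> d0 nq qu; have two : 1 <= 2 :> R by rewrite ler1n.
have step : n%:R `^ d%:R^-1 <= (2 ^ u)%N%:R :> R.
  apply: (@le_trans _ _ ((2 ^ (d * u))%N%:R `^ d%:R^-1)).
    apply: ge0_ler_powR; rewrite ?nnegrE ?invr_ge0 ?ler0n // ler_nat.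
    by rewrite (leq_trans nq) // leq_pexp2l.
  rewrite mulnC expnM natrX -powR_mulrn ?ler0n // -powRrM mulfV ?powRr1 ?ler0n //.
  by rewrite pnatr_eq0 -lt0n.
apply: (@le_trans _ _ (2 `^ (2 ^ u)%N%:R)); first exact: ler_powR.
by rewrite powR_mulrn ?ler0n // natrX.
Qed.

Theorem theorem1p4 (R : realType) :
  exists F : forall n : nat, cnf n,
    [/\ forall n : nat, unsat (F n),
        poly_size F
      & exists eps : R, 0 < eps /\
          forall c : nat, exists n0 : nat, forall n : nat, (n0 <= n)%N ->
            forall T : sp_tree n, spstar_refutation R c (F n) T ->
              2 `^ (n%:R `^ eps) <= (sp_size T)%:R].
Proof.
(* The rounding places [n] in the range required by [hard_cnf_expn]. *)
pose lg n := (trunc_log 2 n %/ 6)%N.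
pose hard n (F : cnf n) := (5 <= lg n)%N ->
  forall (T : sp_tree n) (M kappa : nat), sp_refutation F T ->
      {in sp_coefs T, forall z : int, `|z| <= M%:Z} ->
      (2 * (n.+1 * M) + 4 <= 2 ^ kappa)%N ->
      (2 ^ 2 ^ lg n <= 2 ^ (14 * lg n + 23) * (sp_size T).+1 ^ kappa.+1)%N.
have lgP n : (5 <= lg n)%N -> (2 ^ (6 * lg n) <= n < 2 ^ (6 * lg n + 6))%N.
  move=> l5; have n0 : (0 < n)%N by case: n l5.
  have /andP[h1 h2] := trunc_log_bounds (isT : (1 < 2)%N) n0.
  apply/andP; split.
    by apply: leq_trans h1; rewrite leq_pexp2l // mulnC leq_trunc_div.
  apply: leq_trans h2 _; rewrite leq_pexp2l // /lg.
  by move: (trunc_log 2 n) => t; lia.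
have ex n : exists F : cnf n,
    [/\ unsat F, (size F <= n ^ 4 + 4)%N & hard n F].
  case: (leqP 5 (lg n)) => l5.
    have /andP[nl nu] := lgP n l5.
    have [F [uF sF hF]] := hard_cnf_expn l5 nl nu.
    exists F; split; [exact: uF | | by move=> _; exact: hF].
    exact: leq_trans sF (leq_addr _ _).
  (* For small [n] the empty clause suffices, as [hard] is then vacuous. *)
  exists [:: (set0, set0)]; split.
  - move=> x; rewrite /cnf_sat /= andbT /clause_sat /=.
    by apply/norP; split; apply/exists_inPn => i; rewrite inE.
  - by rewrite addnS.
  - by rewrite /hard leqNgt l5.
pose F n := projT1 (cid (ex n)).
have FP n : [/\ unsat (F n), (size (F n) <= n ^ 4 + 4)%N & hard n (F n)].
  exact: projT2 (cid (ex n)).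
exists F; split; first by move=> n; have [] := FP n.
  by exists 4%N => n; have [] := FP n.
(* [24 = 6 * 4]: [n] is about [2 ^ (6 l)] and the size bound about [2 ^ 2 ^ (l / 4)]. *)
exists 24%:R^-1; split; first by rewrite invr_gt0 ltr0n.
move=> c; have [l0 hl0] := final_growth c.
exists (2 ^ (6 * (l0 + 5)))%N => n hn T [rT bT].
have ll : (l0 + 5 <= lg n)%N.
  by rewrite leq_divRL // mulnC trunc_log_max.
have l5 : (5 <= lg n)%N := leq_trans (leq_addl _ _) ll.
have /andP[nl nu] := lgP n l5; set l := lg n in ll l5 nl nu.
have n0 : (0 < n)%N by apply: leq_trans nl; rewrite expn_gt0.
set q := (6 * l + 6)%N in nu; pose M := (2 ^ q ^ c.+1)%N.
(* Chosen so that [2 ^ kappa = 2 ^ (q + 3) * M], which exceeds [2 (n + 1) M + 4] because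
   [n < 2 ^ q]. *)
pose kappa := (q + 3 + q ^ c.+1)%N.
have big : (2 ^ 2 ^ l <= 2 ^ (14 * l + 23) * (sp_size T).+1 ^ kappa.+1)%N.
  have [_ _ H] := FP n; apply: (H l5 T M kappa rT).
    move=> z /bT h; have := le_trans h (quasipoly_le R c n0 (ltnW nu)).
    by rewrite -(ler_int R) => /le_trans; apply.
  apply: (@leq_trans (2 ^ q.+3 * M)); last first.
    by rewrite /kappa addn3 expnD.
  have M0 : (0 < M)%N by rewrite expn_gt0.
  rewrite !expnS; move: (2 ^ q)%N nu M M0 => x xn y y0.
  by have := leq_mul xn (leqnn y); have := leq_mul y0 xn; lia.
rewrite leNgt; apply/negP=> small.
have sU : (sp_size T < 2 ^ 2 ^ (l %/ 4).+1)%N.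
  rewrite -(ltr_nat R); apply: lt_le_trans small _.
  by apply: (@powR_pow2_le R n q) => //; [exact: ltnW | rewrite /q; lia].
have := hl0 l (leq_trans (leq_addr _ _) ll); rewrite ltnNge => /negP; apply.
rewrite -(@leq_exp2l 2) //; apply: leq_trans big _.
rewrite [leqRHS]expnD leq_mul2l; apply/orP; right.
rewrite expnM (_ : (6 * l + 6 + 4 + _)%N = kappa.+1) ?leq_exp2r //.
by rewrite /kappa /q; lia.
Qed.
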